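(* Let $\mathbb{F}$ be an infinite field of arbitrary characteristic, let $\mathsf{A}_1$ be the Weyl algebra over $\mathbb{F}$ with generators $x,y$, and let $\mathsf{V}=\mathbb{F}\text{-}\mathrm{span}\{x,y\}\subset\mathsf{A}_1$. The following elements of $\mathbb{F}\langle X\rangle$ are weak polynomial identities for the pair $(\mathsf{A}_1,\mathsf{V})$: (i) $\Gamma_m(x_1,\ldots,x_m)=[[x_1,x_2],x_3\cdots x_m]$ for all $m\ge 3$; (ii) $\mathrm{St}_3(x_1,x_2,x_3)=x_1[x_2,x_3]-x_2[x_1,x_3]+x_3[x_1,x_2]$; (iii) $T_4(x_1,\ldots,x_4)=[x_1,x_2][x_3,x_4]-[x_1,x_3][x_2,x_4]+[x_2,x_3][x_1,x_4]$.
   Context: The Weyl algebra is the unital associative algebra $\mathsf{A}_1=\mathbb{F}\langle x,y\rangle/(yx-xy-1)$. $\mathbb{F}\langle X\rangle$ is the free unital associative $\mathbb{F}$-algebra on free generators $x_1,x_2,\ldots$, and $[a,b]=ab-ba$. A weak polynomial identity for the pair $(\mathsf{A}_1,\mathsf{V})$ is an element $f(x_1,\ldots,x_m)\in\mathbb{F}\langle X\rangle$ such that $f(v_1,\ldots,v_m)=0$ in $\mathsf{A}_1$ for all $v_1,\ldots,v_m\in\mathsf{V}$. *)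

(* Defs.v *)
From HB Require Import structures.
From mathcomp Require Import all_boot all_algebra.
From mathcomp Require Import finmap.
From mathcomp Require Import boolp classical_sets functions cardinality.
From mathcomp.multinomials Require Import monalg.

Set Implicit Arguments.
Unset Strict Implicit.
Unset Printing Implicit Defensive.

Import GRing.Theory.
Local Open Scope ring_scope.
Local Open Scope quotient_scope.

Definition bracket (R : pzRingType) (a b : R) : R := a * b - b * a.

(** * Free unital associative algebras *)

Notation free_alg F I := {malg F[{fmonom I}]}.

Definition fvar (F : fieldType) (I : choiceType) (i : I) : free_alg F I :=
  << fmu i >>.

Lemma free_alg_scaleAr (F : fieldType) (I : choiceType) (a : F)
    (u v : free_alg F I) : a *: (u * v) = u * (a *: v).
Proof.
apply/malgP => k; rewrite mcoeffZ mcoeffMl mulr_sumr.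
rewrite (mcoeffMlw k (fsubset_refl (msupp u)) (msuppZ_le a v)).
apply: eq_bigr => k1 _; rewrite mulr_sumr; apply: eq_bigr => k2 _.
by rewrite mcoeffZ mulrnAr mulrCA.
Qed.

(* The unique algebra morphism sending each fvar i to v i. *)
Definition free_eval (F : fieldType) (I : choiceType) (A : algType F)
    (v : I -> A) (f : free_alg F I) : A :=
  mmap (in_alg A) (fun w : {fmonom I} => \prod_(i <- w) v i) f.

Section FreeEval.
Variables (F : fieldType) (I : choiceType) (A : algType F) (v : I -> A).

Lemma free_eval_var i : free_eval v (fvar F i) = v i.
Proof. by rewrite /free_eval mmapU /= scale1r mul1r fmU big_seq1. Qed.

Lemma free_eval_is_zmod_morphism : zmod_morphism (free_eval v).
Proof. exact: mmapB. Qed.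

Lemma free_eval_is_monoid_morphism : monoid_morphism (free_eval v).
Proof.
split=> [|f g]; first by rewrite /free_eval mmapU /= scale1r mul1r fm1 big_nil.
rewrite /free_eval malgME raddf_sum mulr_suml /=.
apply: eq_bigr => w1 _; rewrite raddf_sum mulr_sumr /=; apply: eq_bigr => w2 _.
rewrite mmapU /= fmM big_cat /= !mulr_algl.
by rewrite -scalerAl -scalerAr scalerA.
Qed.

Lemma free_eval_is_scalable : scalable (free_eval v).
Proof.
move=> a f; rewrite -mul_malgC free_eval_is_monoid_morphism.2 /=.
by rewrite [X in X * _]/free_eval mmapU /= fm1 big_nil mulr1 mulr_algl.
Qed.

HB.instance Definition _ := GRing.isZmodMorphism.Build (free_alg F I) A
  (free_eval v) free_eval_is_zmod_morphism.
HB.instance Definition _ := GRing.isMonoidMorphism.Build (free_alg F I) A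
  (free_eval v) free_eval_is_monoid_morphism.
HB.instance Definition _ := GRing.isScalable.Build F (free_alg F I) A *:%R
  (free_eval v) free_eval_is_scalable.

End FreeEval.

(** * Quotients by two-sided ideals *)

(* The two-sided ideal generated by g: all finite sums of terms a * g * b. *)
Definition in_two_sided_ideal (R : pzRingType) (g p : R) : Prop :=
  exists s : seq (R * R), p = \sum_(t <- s) t.1 * g * t.2.

Definition two_sided_ideal (R : pzRingType) (g : R) : {pred R} :=
  fun p => `[< in_two_sided_ideal g p >].

Section TwoSidedIdeal.
Variables (R : pzRingType) (g : R).
Implicit Types p q a : R.

Lemma two_sided_idealP p :
  reflect (in_two_sided_ideal g p) (p \in two_sided_ideal g).
Proof. exact: asboolP. Qed.

Lemma two_sided_ideal_zmod_closed : zmod_closed (two_sided_ideal g).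
Proof.
split; first by apply/two_sided_idealP; exists [::]; rewrite big_nil.
move=> p q /two_sided_idealP[s ->] /two_sided_idealP[t ->].
apply/two_sided_idealP; exists (s ++ [seq (- u.1, u.2) | u <- t]).
rewrite big_cat big_map /= -sumrN; congr (_ + _).
by apply: eq_bigr => u _; rewrite !mulNr.
Qed.

HB.instance Definition _ := GRing.isZmodClosed.Build R (two_sided_ideal g)
  two_sided_ideal_zmod_closed.

Lemma two_sided_idealMl a p :
  p \in two_sided_ideal g -> a * p \in two_sided_ideal g.
Proof.
move=> /two_sided_idealP[s ->]; apply/two_sided_idealP.
exists [seq (a * u.1, u.2) | u <- s]; rewrite big_map mulr_sumr.
by apply: eq_bigr => u _; rewrite !mulrA.
Qed.

Lemma two_sided_idealMr a p :
  p \in two_sided_ideal g -> p * a \in two_sided_ideal g.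
Proof.
move=> /two_sided_idealP[s ->]; apply/two_sided_idealP.
exists [seq (u.1, u.2 * a) | u <- s]; rewrite big_map mulr_suml.
by apply: eq_bigr => u _; rewrite !mulrA.
Qed.

Lemma two_sided_ideal_gen : g \in two_sided_ideal g.
Proof.
by apply/two_sided_idealP; exists [:: (1, 1)]; rewrite big_seq1 mul1r mulr1.
Qed.

End TwoSidedIdeal.

(** * The Weyl algebra *)

(* free_alg F bool is F<x, y>, with x indexed by false and y by true. *)
Definition weyl_rel (F : fieldType) : free_alg F bool :=
  let x := fvar F false in let y := fvar F true in y * x - x * y - 1.

(* The action of F<x, y> on {poly F} by x = multiplication by 'X and
   y = d/d'X kills weyl_rel, so that the Weyl algebra is not zero. *)
Section PolyAction.
Variable F : fieldType.
Implicit Types (p q : free_alg F bool) (u : {poly F}).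

Let op (b : bool) (u : {poly F}) : {poly F} := if b then u^`() else 'X * u.

Let opw (w : {fmonom bool}) (u : {poly F}) : {poly F} := foldr op u w.

Let act p u : {poly F} := \sum_(w <- msupp p) p@_w *: opw w u.

Let opw_lin w a u v : opw w (a *: u + v) = a *: opw w u + opw w v.
Proof.
rewrite /opw; elim: (w : seq bool) => //= b s ->.
by case: b => /=; rewrite ?derivD ?derivZ ?mulrDr ?scalerAr.
Qed.

Let opwM w1 w2 u : opw (mmul w1 w2) u = opw w1 (opw w2 u).
Proof. by rewrite /opw fmM foldr_cat. Qed.

Let actEw (d : {fset {fmonom bool}}) p u : (msupp p `<=` d)%fset ->
  act p u = \sum_(w <- d) p@_w *: opw w u.
Proof.
move=> le; rewrite /act (big_fset_incl _ le) // => w _ /mcoeff_outdom ->.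
by rewrite scale0r.
Qed.

Let actD p q u : act (p + q) u = act p u + act q u.
Proof.
rewrite (actEw u (msuppD_le p q)).
rewrite (actEw (p := p) u (fsubsetUl _ (msupp q))).
rewrite (actEw (p := q) u (fsubsetUr (msupp p) _)) -big_split.
by apply: eq_bigr => w _; rewrite mcoeffD scalerDl.
Qed.

Let act0 u : act 0 u = 0.
Proof. by rewrite /act msupp0 big_seq_fset0. Qed.

Let actN p u : act (- p) u = - act p u.
Proof. by apply/eqP; rewrite -addr_eq0 -actD addNr act0. Qed.

Let actU c w u : act << c *g w >> u = c *: opw w u.
Proof. by rewrite (actEw u msuppU_le) big_seq_fset1 mcoeffUU. Qed.

Let act_sum (J : Type) (r : seq J) (G : J -> free_alg F bool) u :
  act (\sum_(j <- r) G j) u = \sum_(j <- r) act (G j) u.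
Proof. exact: (big_morph (act^~ u) (fun p q => actD p q u) (act0 u)). Qed.

Let opw0 w : opw w 0 = 0.
Proof. by have := opw_lin w (-1) 0 0; rewrite scaler0 addr0 scaleN1r addNr. Qed.

Let opwZ w a u : opw w (a *: u) = a *: opw w u.
Proof. by have := opw_lin w a u 0; rewrite opw0 !addr0. Qed.

Let opw_sum w (J : Type) (r : seq J) (G : J -> {poly F}) :
  opw w (\sum_(j <- r) G j) = \sum_(j <- r) opw w (G j).
Proof.
have opwD u v : opw w (u + v) = opw w u + opw w v.
  by have := opw_lin w 1 u v; rewrite !scale1r.
exact: (big_morph (opw w) opwD (opw0 w)).
Qed.

Let actM p q u : act (p * q) u = act p (act q u).
Proof.
rewrite malgME act_sum [RHS]/act; apply: eq_bigr => w1 _.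
rewrite act_sum [act q u]/act opw_sum scaler_sumr; apply: eq_bigr => w2 _.
by rewrite actU opwM opwZ scalerA.
Qed.

Let act0r p : act p 0 = 0.
Proof. by rewrite /act big1 // => w _; rewrite opw0 scaler0. Qed.

Let act_rel u : act (weyl_rel F) u = 0.
Proof.
have act_var b v : act (fvar F b) v = op b v.
  by rewrite /fvar actU scale1r /opw fmU.
have act1 v : act 1 v = v by rewrite actU scale1r /opw fm1.
rewrite /weyl_rel /= !(actD, actN, actM) !act_var act1 /= derivM derivX mul1r.
by rewrite addrK subrr.
Qed.

Lemma weyl_ideal_proper : 1 \notin two_sided_ideal (weyl_rel F).
Proof.
apply/negP => /two_sided_idealP[s /(congr1 (act^~ 1))].
have -> : act 1 1 = 1 by rewrite actU scale1r /opw fm1.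
rewrite act_sum big1 => [/eqP|t _]; first by rewrite oner_eq0.
by rewrite !actM act_rel act0r.
Qed.

End PolyAction.

Definition weyl (F : fieldType) := Quotient.quot (two_sided_ideal (weyl_rel F)).

Section WeylAlgebra.
Variable F : fieldType.
Local Notation I := (two_sided_ideal (weyl_rel F)).
Local Notation P := (free_alg F bool).
Local Notation A := (weyl F).

HB.instance Definition _ := Choice.on A.
HB.instance Definition _ : EqQuotient P (Quotient.equiv I) A :=
  EqQuotient.on A.
HB.instance Definition _ := GRing.Zmodule.on A.
HB.instance Definition _ := ZmodQuotient.on A.

Lemma weyl_eqP (p q : P) : reflect (\pi_A p = \pi_A q) (p - q \in I).
Proof. by rewrite (Quotient.idealrBE I); apply: eqP. Qed.

Definition weyl_one : A := lift_cst A 1.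
Definition weyl_mul := lift_op2 A *%R.
Definition weyl_scale (a : F) := lift_op1 A ( *:%R a).

Let pi_repr (p : P) : p - repr (\pi_A p) \in I.
Proof. by apply/weyl_eqP; rewrite reprK. Qed.

Let pi_one : \pi_A 1 = weyl_one.
Proof. by rewrite /weyl_one; unlock. Qed.

Let pi_mul (p q : P) : \pi_A (p * q) = weyl_mul (\pi_A p) (\pi_A q).
Proof.
rewrite /weyl_mul; unlock; apply/weyl_eqP.
set p' := repr _; set q' := repr _.
rewrite -[p * q](addrNK (p * q')) -mulrBr -addrA -mulrBl rpredD //.
  exact/two_sided_idealMl/pi_repr.
exact/two_sided_idealMr/pi_repr.
Qed.

Let pi_scale (a : F) (p : P) : \pi_A (a *: p) = weyl_scale a (\pi_A p).
Proof.
rewrite /weyl_scale; unlock; apply/weyl_eqP.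
by rewrite -scalerBr -mul_malgC; apply/two_sided_idealMl/pi_repr.
Qed.

Let pi_add (p q : P) : \pi_A (p + q) = \pi_A p + \pi_A q.
Proof. exact: pi_addr. Qed.

Let weylW (Q : A -> Prop) : (forall p : P, Q (\pi_A p)) -> forall u, Q u.
Proof. by move=> Qpi u; rewrite -[u]reprK. Qed.

Let weyl_mulA : associative weyl_mul.
Proof.
by elim/weylW => p; elim/weylW => q; elim/weylW => r; rewrite -!pi_mul mulrA.
Qed.

Let weyl_mul1l : left_id weyl_one weyl_mul.
Proof. by elim/weylW => p; rewrite -pi_one -pi_mul mul1r. Qed.

Let weyl_mul1r : right_id weyl_one weyl_mul.
Proof. by elim/weylW => p; rewrite -pi_one -pi_mul mulr1. Qed.

Let weyl_mulDl : left_distributive weyl_mul +%R.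
Proof.
elim/weylW => p; elim/weylW => q; elim/weylW => r.
by rewrite -!pi_mul -!pi_add -pi_mul mulrDl.
Qed.

Let weyl_mulDr : right_distributive weyl_mul +%R.
Proof.
elim/weylW => p; elim/weylW => q; elim/weylW => r.
by rewrite -!pi_mul -!pi_add -pi_mul mulrDr.
Qed.

Let weyl_one_neq0 : weyl_one != 0.
Proof.
rewrite -pi_one -[0]pi_zeror; apply/eqP => /weyl_eqP.
by rewrite subr0; apply/negP/weyl_ideal_proper.
Qed.

HB.instance Definition _ := GRing.Zmodule_isNzRing.Build A
  weyl_mulA weyl_mul1l weyl_mul1r weyl_mulDl weyl_mulDr weyl_one_neq0.

HB.instance Definition _ := @isNzRingQuotient.Build
  P (Quotient.equiv I) 0 -%R +%R 1 *%R A pi_one pi_mul.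

Let weyl_scaleA a b u : weyl_scale a (weyl_scale b u) = weyl_scale (a * b) u.
Proof. by elim/weylW: u => p; rewrite -!pi_scale scalerA. Qed.

Let weyl_scale1 : left_id 1 weyl_scale.
Proof. by elim/weylW => p; rewrite -pi_scale scale1r. Qed.

Let weyl_scaleDr : right_distributive weyl_scale +%R.
Proof.
move=> a; elim/weylW => p; elim/weylW => q.
by rewrite -!pi_scale -!pi_add -pi_scale scalerDr.
Qed.

Let weyl_scaleDl u : {morph weyl_scale^~ u : a b / a + b}.
Proof. by elim/weylW: u => p a b; rewrite -!pi_scale -pi_add scalerDl. Qed.

HB.instance Definition _ := GRing.Zmodule_isLmodule.Build F A
  weyl_scaleA weyl_scale1 weyl_scaleDr weyl_scaleDl.

Let weyl_scaleAl (a : F) (u v : A) : a *: (u * v) = (a *: u) * v.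
Proof.
elim/weylW: u => p; elim/weylW: v => q; rewrite -rmorphM.
by rewrite /GRing.scale /= -!pi_scale scalerAl rmorphM.
Qed.

HB.instance Definition _ := GRing.Lmodule_isLalgebra.Build F A weyl_scaleAl.

Let weyl_scaleAr (a : F) (u v : A) : a *: (u * v) = u * (a *: v).
Proof.
elim/weylW: u => p; elim/weylW: v => q; rewrite -rmorphM.
by rewrite /GRing.scale /= -!pi_scale free_alg_scaleAr rmorphM.
Qed.

HB.instance Definition _ := GRing.Lalgebra_isAlgebra.Build F A weyl_scaleAr.

Lemma weyl_piZ (a : F) (p : P) : \pi_A (a *: p) = a *: \pi_A p.
Proof. exact: pi_scale. Qed.

Definition weyl_x : A := \pi_A (fvar F false).
Definition weyl_y : A := \pi_A (fvar F true).

Lemma weyl_yx : weyl_y * weyl_x = weyl_x * weyl_y + 1.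
Proof.
have /weyl_eqP : weyl_rel F - 0 \in I by rewrite subr0 two_sided_ideal_gen.
rewrite /weyl_rel /= !rmorphB !rmorphM rmorph1 rmorph0 => /eqP.
by rewrite -addrA -opprD subr_eq0 => /eqP.
Qed.

Definition weyl_V : set A :=
  [set v | exists a b : F, v = a *: weyl_x + b *: weyl_y]%classic.

End WeylAlgebra.

(** * Weak polynomial identities *)

(* F<X>; the generator x_i, i >= 1, is fvar F i.-1. *)
Notation FX F := (free_alg F nat).

Definition Xvar (F : fieldType) (i : nat) : FX F := fvar F i.-1.

(* f involves finitely many generators only, so that, V being nonempty, assigning
   a value to every generator amounts to substituting v_1, ..., v_m in
   f(x_1, ..., x_m). *)
Definition weak_identity (F : fieldType) (A : algType F) (V : set A)
    (f : FX F) : Prop :=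
  forall v : nat -> A, (forall i, V (v i)) -> free_eval v f = 0.

Section Identities.
Variable F : fieldType.
Local Notation "''x_' i" := (Xvar F i) (at level 8, i at level 2).

Definition Gamma (m : nat) : FX F :=
  bracket (bracket 'x_1 'x_2) (\prod_(3 <= i < m.+1) 'x_i).

Definition St3 : FX F :=
  'x_1 * bracket 'x_2 'x_3 - 'x_2 * bracket 'x_1 'x_3
  + 'x_3 * bracket 'x_1 'x_2.

Definition T4 : FX F :=
  bracket 'x_1 'x_2 * bracket 'x_3 'x_4
  - bracket 'x_1 'x_3 * bracket 'x_2 'x_4
  + bracket 'x_2 'x_3 * bracket 'x_1 'x_4.

End Identities.

(* Main.v *)
Require Import Defs.
From mathcomp Require Import all_boot all_algebra.
From mathcomp Require Import classical_sets cardinality.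
From mathcomp.multinomials Require Import monalg.
From mathcomp Require Import ring.

(** The commutator is an alternating bilinear form and [y, x] = 1, so on the
    plane V it takes scalar values: [v, w] is minus the determinant of the
    coordinates of v and w (bracket_plane).  Scalars are central, which gives
    the Gamma identities at once.  It also turns the two remaining identities
    into identities between 2 x 2 determinants over F: St_3 becomes Cramer's
    relation v1 |v2 v3| - v2 |v1 v3| + v3 |v1 v2| = 0 between three vectors of
    a plane (standard3_plane), and T_4 becomes the Pluecker relation between
    the maximal minors of a 2 x 4 matrix (plucker4_plane).  The argument takes
    place in any algebra with elements x, y such that [y, x] = 1. *)

Set Implicit Arguments.
Unset Strict Implicit.
Unset Printing Implicit Defensive.

Import GRing.Theory.
Local Open Scope ring_scope.

(** The standard polynomial of degree 3, grouped by its leftmost factor and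
    taken over any ring: a free algebra to read off St_3, its image under
    evaluation to compute the value. *)
Definition standard3 (R : pzRingType) (a b c : R) : R :=
  a * bracket b c - b * bracket a c + c * bracket a b.

(** The three-term Pluecker relation, with brackets in place of minors. *)
Definition plucker4 (R : pzRingType) (a b c d : R) : R :=
  bracket a b * bracket c d - bracket a c * bracket b d
  + bracket b c * bracket a d.

Section RingMorphism.
Variables (R S : pzRingType) (f : {rmorphism R -> S}).
Implicit Types a b c d : R.

Lemma rmorph_bracket a b : f (bracket a b) = bracket (f a) (f b).
Proof. by rewrite /bracket rmorphB !rmorphM. Qed.

Lemma rmorph_standard3 a b c :
  f (standard3 a b c) = standard3 (f a) (f b) (f c).
Proof. by rewrite /standard3 rmorphD rmorphB !rmorphM !rmorph_bracket. Qed.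

Lemma rmorph_plucker4 a b c d :
  f (plucker4 a b c d) = plucker4 (f a) (f b) (f c) (f d).
Proof. by rewrite /plucker4 rmorphD rmorphB !rmorphM !rmorph_bracket. Qed.

End RingMorphism.

Lemma free_eval_Xvar (F : fieldType) (A : algType F) (v : nat -> A) (i : nat) :
  free_eval v (Xvar F i) = v i.-1.
Proof. exact: free_eval_var. Qed.

Section BracketBilinear.
Variables (F : fieldType) (A : algType F).
Implicit Types (a b c d : F) (x y u v w : A).

Lemma bracket_scalarl a u : bracket a%:A u = 0.
Proof. by rewrite /bracket mulr_algl mulr_algr subrr. Qed.

Lemma bracketxx u : bracket u u = 0.
Proof. exact: subrr. Qed.

Lemma bracketC u v : bracket u v = - bracket v u.
Proof. by rewrite /bracket opprB. Qed.

Lemma bracket_linearl a b u v w :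
  bracket (a *: u + b *: v) w = a *: bracket u w + b *: bracket v w.
Proof.
rewrite /bracket mulrDl mulrDr -!scalerAl -!scalerAr !scalerBr opprD.
exact: addrACA.
Qed.

Lemma bracket_linearr a b u v w :
  bracket w (a *: u + b *: v) = a *: bracket w u + b *: bracket w v.
Proof.
by rewrite bracketC bracket_linearl opprD -!scalerN -!(bracketC w).
Qed.

(** Alternating bilinear forms on a plane are multiples of the determinant. *)
Lemma bracket_span2 a b c d x y :
  bracket (a *: x + b *: y) (c *: x + d *: y) = (b * c - a * d) *: bracket y x.
Proof.
rewrite bracket_linearl !bracket_linearr !bracketxx !scaler0 add0r addr0.
by rewrite (bracketC x) !scalerA scalerN addrC -scalerBl.
Qed.

End BracketBilinear.

Section CanonicalPair.
Variables (F : fieldType) (A : algType F) (x y : A).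
Hypothesis bracket_yx : bracket y x = 1.
Local Notation vec a b := (a *: x + b *: y).
Implicit Types a b : F.

Lemma bracket_plane a1 b1 a2 b2 :
  bracket (vec a1 b1) (vec a2 b2) = (b1 * a2 - a1 * b2)%:A.
Proof. by rewrite bracket_span2 bracket_yx. Qed.

(** Cramer's relation: once the brackets are scalars, each coordinate is a
    3 x 3 determinant with a repeated row. *)
Lemma standard3_plane a1 b1 a2 b2 a3 b3 :
  standard3 (vec a1 b1) (vec a2 b2) (vec a3 b3) = 0.
Proof.
rewrite /standard3 !bracket_plane !mulr_algr !scalerDr !scalerA opprD.
(* Collect the coordinates along x and along y. *)
rewrite [X in X + (_ + _)]addrACA [LHS]addrACA -!scalerBl -!scalerDl.
rewrite [X in X *: x](_ : _ = 0); last by ring.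
by rewrite [X in X *: y](_ : _ = 0); [rewrite !scale0r addr0 | ring].
Qed.

(** The brackets are, up to sign, the maximal minors of the 2 x 4 matrix of
    coordinates; the signs cancel in products of two brackets. *)
Lemma plucker4_plane a1 b1 a2 b2 a3 b3 a4 b4 :
  plucker4 (vec a1 b1) (vec a2 b2) (vec a3 b3) (vec a4 b4) = 0.
Proof.
rewrite /plucker4 !bracket_plane !mulr_algr !scalerA -scalerBl -scalerDl.
by rewrite [X in X *: _](_ : _ = 0); [rewrite scale0r | ring].
Qed.

End CanonicalPair.

Section WeylPlane.
Variable F : fieldType.

Lemma weyl_bracket_yx : bracket (weyl_y F) (weyl_x F) = 1.
Proof. by rewrite /bracket weyl_yx addrAC subrr add0r. Qed.

Lemma Gamma_weak_identity m : weak_identity (@weyl_V F) (Gamma F m).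
Proof.
move=> v Vv; rewrite /Gamma !rmorph_bracket /= !free_eval_Xvar /=.
have [a [b ->]] := Vv 0%N; have [c [d ->]] := Vv 1%N.
by rewrite (bracket_plane weyl_bracket_yx) bracket_scalarl.
Qed.

Lemma St3_weak_identity : weak_identity (@weyl_V F) (St3 F).
Proof.
move=> v Vv; rewrite [free_eval v _]rmorph_standard3 /= !free_eval_Xvar /=.
have [a1 [b1 ->]] := Vv 0%N; have [a2 [b2 ->]] := Vv 1%N.
have [a3 [b3 ->]] := Vv 2%N.
exact: (standard3_plane weyl_bracket_yx).
Qed.

Lemma T4_weak_identity : weak_identity (@weyl_V F) (T4 F).
Proof.
move=> v Vv; rewrite [free_eval v _]rmorph_plucker4 /= !free_eval_Xvar /=.
have [a1 [b1 ->]] := Vv 0%N; have [a2 [b2 ->]] := Vv 1%N.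
have [a3 [b3 ->]] := Vv 2%N; have [a4 [b4 ->]] := Vv 3%N.
exact: (plucker4_plane weyl_bracket_yx).
Qed.

End WeylPlane.

Theorem lemma4p1 (F : fieldType) (infF : infinite_set [set: F]%classic) :
  [/\ forall m : nat, (3 <= m)%N -> weak_identity (@weyl_V F) (Gamma F m),
      weak_identity (@weyl_V F) (St3 F)
    & weak_identity (@weyl_V F) (T4 F)].
Proof.
split=> [m _||]; first exact: Gamma_weak_identity.
- exact: St3_weak_identity.
- exact: T4_weak_identity.
Qed.
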